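(* Suppose that the support $\mathcal S=\{a\in\mathcal A:p_a>0\}$ is infinite. Assume that, for some $\alpha\in[0,1]$ and some function $\ell$ slowly varying at $+\infty$, we have $\nu(\varepsilon)\le \varepsilon^{-\alpha}\ell(1/\varepsilon)$ for all $0<\varepsilon\le1$. Suppose, in addition, that $\ell$ is non-increasing. Then, for all integers $n\ge 2$ and all integers $0\le r\le n-1$, $$\mathbb E M_{n,r}\le c_{1}(\alpha,r)\,n^{\alpha-1}\ell(n),$$ where $$c_{1}(\alpha,r)= c(r)+\frac{4^{1+r}}{r!}(1+r)^{1+r-\alpha}\,\gamma\left(1+r-\alpha,\tfrac 12\right).$$
   Context: $\mathcal A$ is an at most countable set and $P=\{p_a:a\in\mathcal A\}$ is a probability distribution on $\mathcal A$ ($p_a\in[0,1]$, $\sum_{a}p_a=1$). $X_1,\dots,X_n$ are i.i.d. $\mathcal A$-valued random variables with distribution $P$; $\xi_n(a)=\sum_{i=1}^n\mathbf 1\{X_i=a\}$. For $0\le r\le n$, $M_{n,r}=\sum_{a\in\mathcal A}p_a\mathbf 1\{\xi_n(a)=r\}$. The counting function of $P$ is $\nu(\varepsilon)=|\{a\in\mathcal A:p_a\ge\varepsilon\}|$. A function $\ell:[0,+\infty)\to\mathbb R$ is slowly varying at $+\infty$ if $\ell(cx)/\ell(x)\to1$ as $x\to+\infty$ for every $c>0$. The constant $c(r)$ is $c(0)=e^{-1}$ and $c(r)=e(1+r)/\sqrt{\pi}$ for $r\ge 1$. The lower incomplete Gamma function is $\gamma(t,x)=\int_0^x u^{t-1}e^{-u}\,\mathrm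 du$, with $\gamma(0,\tfrac12)=+\infty$ (so the bound is trivial when $\alpha=1$, $r=0$). *)

(* Defs.v *)
From HB Require Import structures.
From mathcomp Require Export all_boot all_order all_algebra.
From mathcomp Require Export all_classical all_reals all_analysis.
Export Order.TTheory GRing.Theory Num.Theory.
Export numFieldNormedType.Exports.
#[export] Set Implicit Arguments.
#[export] Unset Strict Implicit.
#[export] Unset Printing Implicit Defensive.

Local Open Scope classical_set_scope.
Local Open Scope ring_scope.

(* Where [ell x] vanishes the quotient is 0 in Rocq, so convergence to 1
   entails that [ell] is eventually nonzero. Only the values of [ell] at
   large positive arguments matter, hence [ell] may be total on [R]. *)
Definition slowly_varying (R : realType) (ell : R -> R) : Prop :=
  forall c : R, 0 < c -> ell (c * x) / ell x @[x --> +oo] --> (1 : R).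

Definition counting_fun (R : realType) (A : choiceType) (p : A -> R)
    (eps : R) : \bar R :=
  counting [set a | eps <= p a].

Definition mutually_independent (d d' : measure_display)
    (T : measurableType d) (A : measurableType d') (R : realType)
    (Pr : probability T R) (I : finType) (X : I -> {RV Pr >-> A}) : Prop :=
  forall (J : {set I}) (B : I -> set A), (forall i, measurable (B i)) ->
    Pr (\bigcap_(i in [set` J]) X i @^-1` B i) =
    (\prod_(i in J) Pr (X i @^-1` B i))%E.

(* For [A] countable with the discrete sigma-algebra the law of a random
   variable is determined by its values on singletons. *)
Definition iid_with_law (d d' : measure_display)
    (T : measurableType d) (A : measurableType d') (R : realType)
    (Pr : probability T R) (p : A -> R) (I : finType)
    (X : I -> {RV Pr >-> A}) : Prop :=
  mutually_independent X /\
  forall i a, distribution Pr (X i) [set a] = (p a)%:E.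

(* The number xi_n(a) of indices [i] with [X i w = a]. *)
Definition occupancy (T : Type) (A : eqType) (n : nat) (X : 'I_n -> T -> A)
    (a : A) (w : T) : nat :=
  (\sum_(i < n) (X i w == a))%N.

(* M_{n,r}. For a probability distribution [p] the sum lies in [0, 1], so that
   [fine] loses nothing. *)
Definition occupancy_mass (R : realType) (T : Type) (A : choiceType)
    (p : A -> R) (n : nat) (X : 'I_n -> T -> A) (r : nat) (w : T) : R :=
  fine (\esum_(a in [set: A]) (p a * (occupancy X a w == r)%:R)%:E).

(* The value is extended real: for [x > 0] it is [+oo] exactly when [t <= 0],
   in particular [lower_gamma 0 (1/2) = +oo]. *)
Definition lower_gamma (R : realType) (t x : R) : \bar R :=
  (\int[lebesgue_measure]_(u in `]0%R, x]) (u `^ (t - 1) * expR (- u))%:E)%E.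

Definition c_const (R : realType) (r : nat) : R :=
  if r == 0%N then expR (- 1) else expR 1 * (1 + r)%:R / Num.sqrt pi.

Definition c1_const (R : realType) (alpha : R) (r : nat) : \bar R :=
  ((c_const R r)%:E
   + (4 ^+ (1 + r) / r`!%:R * (1 + r)%:R `^ ((1 + r)%:R - alpha))%:E
     * lower_gamma ((1 + r)%:R - alpha) (1 / 2))%E.

(* Main.v *)
Require Import Defs.
From mathcomp Require Import ring lra measurable_realfun.

Local Open Scope classical_set_scope.
Local Open Scope ring_scope.

(** The number of sample points equal to a letter [a] is binomial with
    parameters [n] and [p a] ([probability_occupancy]), so that the expectation
    of the occupancy mass is the sum over the letters of
    [w (p a) = p a * 'C(n, r) * p a ^ r * (1 - p a) ^ (n - r)]
    ([expectation_occupancy_mass]). The sum of a family of nonnegative terms is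
    the supremum of its finite subsums, so it is enough to bound those. They
    are split at the probability [1 / n].

    Heavy letters, [p a >= 1 / n]: there are at most
    [nu (1 / n) <= n ^ alpha * ell n] of them, and each contributes at most
    [c(r) / n] ([occupancy_weight_le_c_const]). For [r = 0] this is
    [x * exp (- n x) <= exp (- 1) / n]. For [r >= 1] the weight is
    [(r + 1) / (n + 1)] times a term of the binomial distribution with
    parameters [n + 1] and [x], hence at most [(1 + r) / n], and
    [exp 1 >= sqrt pi].

    Light letters, [p a < 1 / n]: since [ell] is non-increasing,
    [nu eps <= eps ^ (- alpha) * ell n] for every [eps <= 1 / n]. The weight is
    at most [n ^ r / r! * x ^ (r + 1)]. With the rescaled probabilities
    [q = n * p a / 2 <= 1 / 2], the layer-cake formula
    [q ^ (r + 1) = \int_0^(1/2) (r + 1) u ^ r 1{u <= q} du] turns the sum of the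
    [q ^ (r + 1)] into an integral against the number of [q]'s above [u], which
    the tail bound makes at most a multiple of
    [\int_0^(1/2) u ^ (r - alpha) du], and [exp (- u) >= 1 / 2] on this range
    brings in the incomplete Gamma function ([sum_expr_le_lower_gamma]). The
    factor 2 of the rescaling is chosen to make [1 / 2] the end point. All of
    this holds in the extended reals, whence the case [alpha = 1], [r = 0],
    where both integrals are infinite, needs no separate treatment. *)

(** * The contribution of a single letter *)

(** The mean of [p a * 1{xi_n(a) = r}] for a letter [a] of probability [x]. *)
Definition occupancy_weight (R : realType) (n r : nat) (x : R) : R :=
  x * ('C(n, r)%:R * x ^+ r * (1 - x) ^+ (n - r)).

Lemma binomial_term_le1 (R : realType) (n k : nat) (x : R) :
  (k <= n)%N -> 0 <= x <= 1 -> 'C(n, k)%:R * x ^+ k * (1 - x) ^+ (n - k) <= 1.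
Proof.
move=> kn /andP[x0 x1].
have E : (1 - x + x) ^+ n = 1 :> R by rewrite subrK expr1n.
rewrite -[leRHS]E [leRHS]exprDn (bigD1 (inord k)) //= inordK ?ltnS//.
rewrite -[X in _ <= X + _]mulr_natl.
rewrite -mulrA (mulrC (x ^+ k)) lerDl sumr_ge0 // => i _.
by rewrite mulrn_wge0 // mulr_ge0 // exprn_ge0 // subr_ge0.
Qed.

Lemma c_const_ge0 (R : realType) (r : nat) : 0 <= c_const R r.
Proof.
rewrite /c_const; case: ifP => _; first exact: expR_ge0.
by rewrite divr_ge0 ?sqrtr_ge0 // mulr_ge0 // expR_ge0.
Qed.

(** This is [exp 1 >= sqrt pi], from [exp 1 >= 2] and [pi <= 4]. *)
Lemma c_const_ge (R : realType) (r : nat) :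
  (0 < r)%N -> (1 + r)%:R <= c_const R r.
Proof.
move=> r0; rewrite /c_const gtn_eqF // ler_pdivlMr ?sqrtr_gt0 ?pi_gt0 //.
rewrite mulrC ler_wpM2r //; apply: (@le_trans _ _ 2); last first.
  by apply: le_trans (@expR_ge1Dx R 1); lra.
have -> : 2 = Num.sqrt (2 ^+ 2) :> R by rewrite sqrtr_sqr ger0_norm.
rewrite ler_sqrt ?exprn_ge0 //.
by have := @pihalf_lt2 R; lra.
Qed.

(** For [r > 0], the identity [(n + 1) 'C(n, r) = (r + 1) 'C(n + 1, r + 1)]
    absorbs the factor [x] into a binomial probability for [n + 1] draws, which
    is at most 1. *)
Lemma occupancy_weight_le_c_const (R : realType) (n r : nat) (x : R) :
  (0 < n)%N -> (r <= n)%N -> 0 <= x <= 1 ->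
  occupancy_weight n r x <= c_const R r / n%:R.
Proof.
move=> n0 rn /[dup] x01 /andP[x0 x1]; rewrite ler_pdivlMr ?ltr0n //.
case: r rn => [|r] rn.
  rewrite /occupancy_weight /c_const eqxx bin0 expr0 !mul1r subn0.
  have xn : (1 - x) ^+ n <= expR (- (n%:R * x)).
    rewrite -mulrN expRM_natl lerXn2r ?nnegrE ?subr_ge0 ?expR_ge0 //.
    exact: expR_ge1Dx.
  apply: (@le_trans _ _ (n%:R * x * expR (- (n%:R * x)))).
    by rewrite mulrC mulrA ler_wpM2l // mulr_ge0.
  (* [y * exp (- y) <= exp (- 1)] at [y = n * x], from [y <= exp (y - 1)] *)
  have : n%:R * x <= expR (n%:R * x - 1).
    by apply: le_trans (expR_ge1Dx _); lra.
  move=> /(ler_wpM2r (expR_ge0 (- (n%:R * x)))); rewrite -expRD => /le_trans.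
  by apply; rewrite ler_expR; lra.
apply: le_trans (@c_const_ge R _ _) => //.
have nx := @binomial_term_le1 _ n.+1 r.+2 x rn x01.
rewrite subSS in nx.
have -> : occupancy_weight n r.+1 x * n%:R =
    (1 + r.+1)%:R * (n%:R / n.+1%:R) *
    ('C(n.+1, r.+2)%:R * x ^+ r.+2 * (1 - x) ^+ (n - r.+1)).
  have := mul_bin_diag n.+1 r.+1 => /(congr1 (fun k => k%:R : R)).
  rewrite !natrM /= => h.
  have nu : n.+1%:R != 0 :> R by rewrite pnatr_eq0.
  rewrite /occupancy_weight (exprS x r.+1) add1n.
  transitivity (n.+1%:R * 'C(n, r.+1)%:R *
      (x * x ^+ r.+1 * (1 - x) ^+ (n - r.+1)) * n%:R / n.+1%:R :> R).
    by field.
  by rewrite h; field.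
have nx0 : 0 <= 'C(n.+1, r.+2)%:R * x ^+ r.+2 * (1 - x) ^+ (n - r.+1).
  apply: mulr_ge0; last by rewrite exprn_ge0 // subr_ge0.
  by rewrite mulr_ge0 // exprn_ge0.
have n1 : n%:R / n.+1%:R <= 1 :> R by rewrite ler_pdivrMr // mul1r ler_nat.
by rewrite -mulrA ler_piMr // mulr_ile1 // ?divr_ge0.
Qed.

Lemma ffact_le_expn n r : (n ^_ r <= n ^ r)%N.
Proof.
elim: r n => [|r IH] [|n] //; rewrite ffactSS expnS leq_mul2l /=.
by apply: leq_trans (IH n) _; case: r {IH} => // r; rewrite leq_exp2r.
Qed.

Lemma occupancy_weight_le_monomial (R : realType) (n r : nat) (x : R) :
  0 <= x <= 1 -> occupancy_weight n r x <= n%:R ^+ r / r`!%:R * x ^+ r.+1.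
Proof.
move=> /andP[x0 x1].
have r0 : 0 < r`!%:R :> R by rewrite ltr0n fact_gt0.
have bin : 'C(n, r)%:R <= n%:R ^+ r / r`!%:R :> R.
  rewrite ler_pdivlMr // -natrM -natrX ler_nat bin_ffact.
  exact: ffact_le_expn.
have -> : occupancy_weight n r x =
    'C(n, r)%:R * x ^+ r.+1 * (1 - x) ^+ (n - r).
  by rewrite /occupancy_weight exprS; ring.
apply: le_trans (ler_wpM2r _ bin); last by rewrite exprn_ge0.
rewrite ler_piMr ?mulr_ge0 ?exprn_ge0 // exprn_ile1 ?subr_ge0 //; lra.
Qed.

(** * Sums over finitely many letters *)

Lemma count_le_counting (R : realType) (T : choiceType) (s : seq T)
    (P : pred T) (B : set T) :
  uniq s -> (forall t, P t -> B t) ->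
  ((count P s)%:R%:E <= (counting B : \bar R))%E.
Proof.
move=> us PB; rewrite /counting; case: ifPn => [/asboolP finB|_].
  rewrite lee_fin ler_nat -size_filter.
  apply: uniq_leq_size; first exact: filter_uniq.
  move=> t; rewrite mem_filter => /andP[Pt _].
  by rewrite in_fset_set // inE; exact: PB.
by rewrite leey.
Qed.

(** The indicator keeps the domain of integration independent of [x], so that
    instances for several [x] can be summed under one integral sign. *)
Lemma expr_layer_cake (R : realType) (r : nat) (x c : R) : 0 <= x <= c ->
  (x ^+ r.+1)%:E = (\int[lebesgue_measure]_(u in `]0%R, c])
    (r.+1%:R * (u : R) ^+ r * (u <= x)%R%:R)%:E)%E.
Proof.
move=> /andP[x0 xc].
have mf : measurable_fun [set: R] (fun u : R => r.+1%:R * u ^+ r).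
  by apply: measurable_funM => //; exact: exprn_measurable.
have step :
    (\int[lebesgue_measure]_(u in `]0%R, x]) (r.+1%:R * (u : R) ^+ r)%:E)%E =
    (x ^+ r.+1)%:E.
  move: x0; rewrite le_eqVlt => /orP[/eqP <-|x0].
    by rewrite set_itvoc0 integral_set0 expr0n.
  rewrite integral_itv_obnd_cbnd; last first.
    by apply/measurable_EFinP; exact: measurable_funTS.
  have cF (y : R) : {for y, continuous (fun y : R => y ^+ r.+1)}.
    exact: exprn_continuous.
  rewrite (@continuous_FTC2 R _ (fun y : R => y ^+ r.+1)) //.
  - by rewrite expr0n sube0.
  - apply: continuous_subspaceT => y.
    by apply: cvgM; [exact: cvg_cst|exact: exprn_continuous].
  - split.
    + by move=> y _; exact: exprn_derivable.
    + exact/cvg_at_right_filter/cF.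
    + exact/cvg_at_left_filter/cF.
  - by move=> y _; rewrite exp_derive1.
rewrite -step.
have -> : `]0, x]%classic = `]0, c]%classic `&` `]0, x]%classic :> set R.
  apply/seteqP; split => u /=; last by case.
  rewrite !in_itv /= => /andP[-> ux]; rewrite ux; split => //.
  exact: le_trans ux xc.
rewrite integral_mkcondr; apply: eq_integral => u.
rewrite inE /= in_itv /= => /andP[u0 _].
rewrite /patch mem_setE in_itv /= u0 /=.
by case: ifP; rewrite ?mulr1 ?mulr0.
Qed.

(** Exchanging sum and integral in the layer-cake formula leaves the number of
    elements above the level [u], to which the tail bound applies. The factor 2
    pays for the factor [exp (- u)] of the Gamma integrand. *)
Lemma sum_expr_le_lower_gamma (R : realType) (r : nat) (alpha K : R)
    (s : seq R) :
  0 <= K -> (forall x, x \in s -> 0 <= x <= 1 / 2) ->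
  (forall u : R, 0 < u <= 1 / 2 ->
     (count (fun x => u <= x) s)%:R <= K * u `^ (- alpha)) ->
  ((\sum_(x <- s) x ^+ r.+1)%:E <=
     (2 * r.+1%:R * K)%:E * lower_gamma (r.+1%:R - alpha) (1 / 2))%E.
Proof.
move=> K0 s01 tail.
have mg : measurable_fun [set: R]
    (fun u : R => u `^ (r.+1%:R - alpha - 1) * expR (- u)).
  apply: measurable_funM; first exact: measurable_powR.
  by apply: measurableT_comp => //; exact: measurable_oppr.
have mf (x : R) :
    measurable_fun [set: R] (fun u : R => r.+1%:R * u ^+ r * (u <= x)%R%:R).
  apply: measurable_funM.
    by apply: measurable_funM => //; exact: exprn_measurable.
  rewrite (_ : (fun _ => _) = \1_(`]-oo, x]%classic : set R)).
    exact: measurable_indic.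
  by apply/funext => u; rewrite indicE mem_setE in_itv.
rewrite -sumEFin.
rewrite (eq_big_seq (fun x => \int[lebesgue_measure]_(u in `]0%R, (1 / 2)%R])
    (r.+1%:R * (u : R) ^+ r * (u <= x)%R%:R)%:E)%E); last first.
  by move=> x /s01; exact: expr_layer_cake.
rewrite -ge0_integral_sum //; last 2 first.
- by move=> x; apply/measurable_EFinP; apply: measurable_funTS; exact: mf.
- move=> x u; rewrite /= in_itv /= => /andP[/ltW u0 _].
  by rewrite lee_fin !mulr_ge0 // exprn_ge0.
rewrite /lower_gamma -ge0_integralZl_EFin //; last 3 first.
- by move=> u _; rewrite lee_fin mulr_ge0 ?powR_ge0 ?expR_ge0.
- by apply/measurable_EFinP; exact: measurable_funTS.
- by rewrite !mulr_ge0.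
apply: ge0_le_integral => //.
- move=> u; rewrite /= in_itv /= => /andP[/ltW u0 _].
  apply: sume_ge0 => x _; rewrite lee_fin !mulr_ge0 //.
  by rewrite exprn_ge0.
- apply: emeasurable_sum => x.
  by apply/measurable_EFinP; apply: measurable_funTS; exact: mf.
- apply/measurable_EFinP; apply: measurable_funM => //.
  exact: measurable_funTS.
move=> u; rewrite /= in_itv /= => /andP[u0 u1].
rewrite sumEFin -EFinM lee_fin -mulr_sumr -natr_sum.
have -> : (\sum_(x <- s) (u <= x)%R = count (fun x => (u <= x)%R) s)%N.
  by rewrite -sum1_count [RHS]big_mkcond; apply: eq_bigr => x _; case: ifP.
have -> : r.+1%:R - alpha - 1 = r%:R + - alpha by rewrite -natr1; lra.
rewrite powRD ?(gt_eqF u0) ?implybT // powR_mulrn ?(ltW u0) //.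
have /(tail u) h : 0 < u <= 1 / 2 by rewrite u0.
have e2 : 1 <= 2 * expR (- u) by have := expR_ge1Dx (- u); lra.
have ur0 : 0 <= r.+1%:R * u ^+ r by rewrite mulr_ge0 // exprn_ge0 // ltW.
apply: le_trans (ler_wpM2l ur0 h) _.
rewrite [leRHS](_ : _ = r.+1%:R * u ^+ r * (K * u `^ (- alpha)) *
  (2 * expR (- u))); last by ring.
by rewrite ler_peMr // mulr_ge0 // mulr_ge0 // powR_ge0.
Qed.

Lemma powR_subr1 (R : realType) (x a : R) : 0 < x -> x `^ (a - 1) = x `^ a / x.
Proof.
by move=> x0; rewrite powRD ?(gt_eqF x0) ?implybT // powR_inv1 ?ltW.
Qed.

Lemma powR_invN (R : realType) (x a : R) : 0 <= x -> x^-1 `^ (- a) = x `^ a.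
Proof. by move=> x0; rewrite -powR_inv1 // -powRrM mulN1r opprK. Qed.

(** At most [n ^ alpha * L] letters are heavy, and the weight of each is at most
    [c(r) / n]. *)
Lemma sum_occupancy_weight_heavy_le (R : realType) (A : choiceType)
    (p : A -> R) (alpha L : R) (n r : nat) (s : seq A) :
  (forall a, 0 <= p a <= 1) -> (0 < n)%N -> (r <= n)%N ->
  (counting_fun p n%:R^-1 <= (n%:R^-1 `^ (- alpha) * L)%:E)%E ->
  uniq s ->
  \sum_(a <- s | n%:R^-1 <= p a) occupancy_weight n r (p a) <=
    c_const R r * (n%:R `^ (alpha - 1) * L).
Proof.
move=> p01 n0 rn nuL us.
have n0R : 0 < n%:R :> R by rewrite ltr0n.
have cnt : (count (fun a => n%:R^-1 <= p a) s)%:R <= n%:R `^ alpha * L.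
  rewrite -(powR_invN _ (ltW n0R)) -lee_fin; apply: le_trans nuL.
  exact: count_le_counting.
apply: (@le_trans _ _
  (\sum_(a <- s | n%:R^-1 <= p a) c_const R r / n%:R)).
  by apply: ler_sum => a _; exact: occupancy_weight_le_c_const.
rewrite big_const_seq iter_addr_0 -[leLHS]mulr_natr powR_subr1 //.
rewrite [leRHS](_ : _ = c_const R r / n%:R * (n%:R `^ alpha * L));
  last by field; rewrite gt_eqF.
by rewrite ler_wpM2l // divr_ge0 // c_const_ge0.
Qed.

Lemma lower_gamma_ge0 (R : realType) (t x : R) : (0 <= lower_gamma t x)%E.
Proof.
by apply: integral_ge0 => u _; rewrite lee_fin mulr_ge0 ?powR_ge0 ?expR_ge0.
Qed.

(** The left-hand side is what the estimate of the light letters produces: a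
    power of two from the rescaling by [n / 2], a factor [2 (r + 1)] from
    [sum_expr_le_lower_gamma], and [2 ^ (- alpha)] from the rescaled tail. *)
Lemma light_coefficient_le (R : realType) (alpha : R) (r : nat) :
  0 <= alpha <= 1 ->
  2 ^+ r.+1 * 2 * r.+1%:R * 2 `^ (- alpha) <=
    4 ^+ (1 + r) * (1 + r)%:R `^ ((1 + r)%:R - alpha).
Proof.
move=> /andP[a0 a1]; rewrite add1n.
have h1 : 2 `^ (- alpha) <= 1 :> R.
  by rewrite -[leRHS](powRr0 2) ler_powR //; [rewrite ler1n|rewrite oppr_le0].
have h2 : r.+1%:R <= r.+1%:R `^ (r.+1%:R - alpha).
  (* the exponent is at least 1 unless [r = 0], when the base is 1 *)
  case: r => [|r]; first by rewrite powR1.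
  rewrite le1r_powR ?ler1n //.
  by rewrite -[r.+2]addn2 natrD; have := ler0n R r; lra.
have h3 : 2 ^+ r.+1 * 2 <= 4 ^+ r.+1 :> R.
  rewrite (_ : 4 = 2 * 2); last by rewrite -natrM.
  rewrite exprMn ler_wpM2l ?exprn_ge0 // exprS ler_peMr //.
  by rewrite exprn_ege1 // ler1n.
rewrite -mulrA ler_pM ?mulr_ge0 ?exprn_ge0 ?powR_ge0 //.
by apply: le_trans h2; rewrite ler_piMr.
Qed.

(** The tail bound at [2 u / n] counts the rescaled probabilities above [u], so
    [sum_expr_le_lower_gamma] applies with [K = (n / 2) ^ alpha * L]. *)
Lemma sum_occupancy_weight_light_le (R : realType) (A : choiceType)
    (p : A -> R) (alpha L : R) (n r : nat) (s : seq A) :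
  (forall a, 0 <= p a <= 1) -> (0 < n)%N -> 0 <= alpha <= 1 -> 0 <= L ->
  (forall eps : R, 0 < eps <= n%:R^-1 ->
    (counting_fun p eps <= (eps `^ (- alpha) * L)%:E)%E) ->
  uniq s ->
  ((\sum_(a <- s | ~~ (n%:R^-1 <= p a)%R) occupancy_weight n r (p a))%:E <=
    (4 ^+ (1 + r) / r`!%:R * (1 + r)%:R `^ ((1 + r)%:R - alpha))%:E
    * lower_gamma ((1 + r)%:R - alpha) (1 / 2)
    * (n%:R `^ (alpha - 1) * L)%:E)%E.
Proof.
move=> p01 n0 a01 L0 nuL us.
have n0R : 0 < n%:R :> R by rewrite ltr0n.
have r0 : 0 < r`!%:R :> R by rewrite ltr0n fact_gt0.
pose K := 2 `^ (- alpha) * n%:R `^ alpha * L.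
have K0 : 0 <= K by rewrite !mulr_ge0 ?powR_ge0.
(* the light letters, with probabilities rescaled to lie below [1 / 2] *)
pose s' := [seq n%:R / 2 * p a | a <- s & ~~ (n%:R^-1 <= p a)].
have s'01 x : x \in s' -> 0 <= x <= 1 / 2.
  move=> /mapP[a]; rewrite mem_filter -ltNge => /andP[pan _] ->.
  have /andP[pa0 _] := p01 a.
  rewrite mulr_ge0 ?divr_ge0 //=.
  rewrite -(ltr_pM2l n0R) mulfV ?gt_eqF // in pan.
  by lra.
have s'K (u : R) : 0 < u <= 1 / 2 ->
    (count (fun x => u <= x) s')%:R <= K * u `^ (- alpha).
  move=> /andP[u0 u1].
  have e0 : 0 < 2 * u / n%:R by rewrite divr_gt0 // mulr_gt0.
  have -> : K * u `^ (- alpha) = (2 * u / n%:R) `^ (- alpha) * L.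
    rewrite powRM ?invr_ge0 ?mulr_ge0 ?(ltW u0) ?(ltW n0R) //.
    rewrite powRM ?(ltW u0) // powR_invN ?(ltW n0R) // /K; ring.
  have en : 0 < 2 * u / n%:R <= n%:R^-1.
    rewrite e0 /= ler_piMl ?invr_ge0 ?(ltW n0R) //; lra.
  rewrite -lee_fin; apply: le_trans (nuL _ en).
  apply: le_trans (@count_le_counting R _ s
    (fun a => 2 * u / n%:R <= p a) _ us (fun _ => id)).
  rewrite lee_fin ler_nat count_map count_filter; apply: sub_count => a /=.
  move=> /andP[ua _]; rewrite ler_pdivrMr //; lra.
have main := sum_expr_le_lower_gamma r K0 s'01 s'K.
have le1 : \sum_(a <- s | ~~ (n%:R^-1 <= p a)) occupancy_weight n r (p a) <=
    2 ^+ r.+1 / (r`!%:R * n%:R) * \sum_(x <- s') x ^+ r.+1.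
  rewrite big_map big_filter mulr_sumr; apply: ler_sum => a _.
  apply: le_trans (occupancy_weight_le_monomial n r (p01 a)) _.
  rewrite le_eqVlt; apply/orP; left; apply/eqP.
  rewrite exprMn expr_div_n (exprS n%:R r); field.
  by rewrite !gt_eqF //= exprn_gt0.
rewrite -lee_fin EFinM in le1; apply: (le_trans le1).
have c0 : (0 <= (2 ^+ r.+1 / (r`!%:R * n%:R))%:E :> \bar R)%E.
  by rewrite lee_fin divr_ge0 ?exprn_ge0 ?mulr_ge0.
apply: (le_trans (lee_wpmul2l c0 main)).
rewrite muleA -EFinM [leRHS]muleAC -EFinM [leLHS]muleC [leRHS]muleC.
rewrite -[r.+1]/(1 + r)%N.
rewrite lee_wpmul2l ?lower_gamma_ge0 // lee_fin powR_subr1 //.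
have := @light_coefficient_le _ _ r a01; rewrite -[r.+1]/(1 + r)%N => cst.
have B0 : 0 <= n%:R `^ alpha / n%:R * L / r`!%:R.
  by rewrite divr_ge0 // mulr_ge0 // divr_ge0 // powR_ge0.
rewrite [leLHS](_ : _ = 2 ^+ (1 + r) * 2 * (1 + r)%:R * 2 `^ (- alpha) *
  (n%:R `^ alpha / n%:R * L / r`!%:R)); last first.
  by rewrite /K; field; rewrite !gt_eqF.
rewrite [leRHS](_ : _ = 4 ^+ (1 + r) * (1 + r)%:R `^ ((1 + r)%:R - alpha) *
  (n%:R `^ alpha / n%:R * L / r`!%:R)); last first.
  by field; rewrite !gt_eqF.
exact: ler_wpM2r.
Qed.

(** * The law of the occupancy of a letter *)

(** Written as an intersection over all indices, with complements outside [J],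
    so that mutual independence applies to it verbatim. *)
Definition hits_exactly (T A : Type) (n : nat) (X : 'I_n -> T -> A) (a : A)
    (J : {set 'I_n}) : set T :=
  \bigcap_(i in [set` [set: 'I_n]%SET])
    X i @^-1` (if i \in J then [set a] else ~` [set a]).

Lemma hits_exactlyE (T : Type) (A : eqType) (n : nat) (X : 'I_n -> T -> A)
    (a : A) (J : {set 'I_n}) (w : T) :
  hits_exactly X a J w <-> J = [set i | X i w == a]%SET.
Proof.
split => [XJ|-> i _].
  apply/setP => i; rewrite inE.
  have := XJ i (finset.in_setT i); rewrite /preimage /=.
  by case: ifP => _ /= /eqP => [->|/negPf ->].
by rewrite /preimage /= inE; case: ifP => [/eqP|/eqP].
Qed.

Lemma occupancy_eventE (T : Type) (A : eqType) (n : nat) (X : 'I_n -> T -> A)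
    (a : A) (r : nat) :
  [set w | occupancy X a w == r] =
  \bigcup_(J in [set` enum [set J : {set 'I_n} | #|J| == r]%SET])
    hits_exactly X a J.
Proof.
have occE w : occupancy X a w = #|[set i | X i w == a]%SET|.
  rewrite /occupancy -sum1_card [RHS]big_mkcond; apply: eq_bigr => i _.
  by rewrite inE; case: eqP.
apply/seteqP; split => w /=.
  rewrite occE => ar; exists [set i | X i w == a]%SET; last exact/hits_exactlyE.
  by rewrite /= mem_enum inE.
move=> [J /=]; rewrite mem_enum inE => Jr /hits_exactlyE EJ.
by rewrite occE -EJ.
Qed.

Lemma trivIset_hits_exactly (T : Type) (A : eqType) (n : nat)
    (X : 'I_n -> T -> A) (a : A) (D : set {set 'I_n}) :
  trivIset D (hits_exactly X a).
Proof.
by move=> J K _ _ [w [/hits_exactlyE -> /hits_exactlyE ->]].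
Qed.

Lemma measurable_hits_exactly
  (R : realType) (d d' : measure_display) (A : measurableType d')
  (T : measurableType d) (Pr : probability T R) (n : nat)
  (X : 'I_n -> {RV Pr >-> A}) (a : A) (J : {set 'I_n}) :
  (forall B : set A, measurable B) ->
  measurable (hits_exactly X a J).
Proof.
move=> A_discrete; apply: fin_bigcap_measurable => // i _.
exact: measurable_funPTI.
Qed.

Lemma measurable_occupancy_event
  (R : realType) (d d' : measure_display) (A : measurableType d')
  (T : measurableType d) (Pr : probability T R) (n : nat)
  (X : 'I_n -> {RV Pr >-> A}) (a : A) (r : nat) :
  (forall B : set A, measurable B) ->
  measurable [set w | occupancy X a w == r].
Proof.
move=> A_discrete; rewrite occupancy_eventE.
apply: fin_bigcup_measurable => [|J _].
  exact: finite_seq.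
exact: measurable_hits_exactly.
Qed.

Lemma probability_hits_exactly
  (R : realType) (d d' : measure_display) (A : measurableType d')
  (T : measurableType d) (Pr : probability T R) (n : nat)
  (X : 'I_n -> {RV Pr >-> A})
  (p : A -> R) (a : A) (J : {set 'I_n}) :
  (forall B : set A, measurable B) ->
  iid_with_law p X ->
  Pr (hits_exactly X a J) = (p a ^+ #|J| * (1 - p a) ^+ (n - #|J|))%:E.
Proof.
move=> A_discrete [indep law].
rewrite /hits_exactly indep //.
transitivity (\prod_(i in [set: 'I_n]%SET)
    (if i \in J then p a else 1 - p a)%:E)%E.
  apply: eq_bigr => i _; case: ifP => _; first exact: law.
  rewrite -preimage_setC probability_setC; last exact: measurable_funPTI.
  by rewrite EFinB; congr (_ - _)%E; exact: law.
rewrite prodEFin; congr (_%:E).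
rewrite (bigID (fun i => i \in J)) /=; congr (_ * _).
  under eq_bigr => i /andP[_ ->] do [].
  by rewrite -prodr_const; apply: eq_bigl => i; rewrite inE.
under eq_bigr => i /andP[_ /negPf ->] do [].
have -> : (n - #|J| = #|~: J|)%N.
  by rewrite [RHS]cardsCs finset.setCK card_ord.
by rewrite -prodr_const; apply: eq_bigl => i; rewrite !inE.
Qed.

(** The event splits according to the set of indices that hit [a]; there are
    ['C(n, r)] such sets of size [r], all of the same probability. *)
Lemma probability_occupancy
  (R : realType) (d d' : measure_display) (A : measurableType d')
  (T : measurableType d) (Pr : probability T R) (n : nat)
  (X : 'I_n -> {RV Pr >-> A})
  (p : A -> R) (a : A) (r : nat) :
  (forall B : set A, measurable B) ->
  iid_with_law p X ->
  Pr [set w | occupancy X a w == r] =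
  ('C(n, r)%:R * p a ^+ r * (1 - p a) ^+ (n - r))%:E.
Proof.
move=> A_discrete X_iid.
rewrite occupancy_eventE measure_fin_bigcup; last 3 first.
- exact: finite_seq.
- exact: trivIset_hits_exactly.
- by move=> J _; exact: measurable_hits_exactly.
rewrite -fsbig_seq ?enum_uniq // big_enum /=.
transitivity (\sum_(J in [set J : {set 'I_n} | #|J| == r]%SET)
    (p a ^+ r * (1 - p a) ^+ (n - r))%:E)%E.
  apply: eq_bigr => J; rewrite inE => /eqP <-.
  exact: probability_hits_exactly.
rewrite sumEFin sumr_const card_draws card_ord; congr (_%:E).
by rewrite -[LHS]mulr_natl mulrA.
Qed.

(** Tonelli for a sum over a countably infinite index set; [e] enumerates it. *)
Lemma integral_esum (R : realType) (d : measure_display)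
    (T : measurableType d) (mu : {measure set T -> \bar R}) (A : choiceType)
    (e : nat -> A) (f : A -> T -> \bar R) :
  set_bij [set: nat] [set: A] e ->
  (forall a, measurable_fun [set: T] (f a)) ->
  (forall a w, (0 <= f a w)%E) ->
  (\int[mu]_w (\esum_(a in [set: A]) f a w))%E =
  \esum_(a in [set: A]) (\int[mu]_w f a w)%E.
Proof.
move=> be mf f0; rewrite (reindex_esum _ _ _ _ be).
transitivity (\int[mu]_w (\sum_(0 <= k <oo) f (e k) w))%E.
  apply: eq_integral => w _.
  by rewrite (reindex_esum _ _ _ _ be) -nneseries_esumT.
rewrite integral_nneseries // nneseries_esumT // => k.
exact: integral_ge0.
Qed.

Lemma expectation_occupancy_mass
  (R : realType) (d d' : measure_display) (A : measurableType d')
  (T : measurableType d) (Pr : probability T R) (n : nat)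
  (X : 'I_n -> {RV Pr >-> A})
  (p : A -> R) (r : nat) :
  (forall B : set A, measurable B) ->
  iid_with_law p X ->
  countable [set: A] -> infinite_set [set: A] ->
  (forall a, 0 <= p a) -> \esum_(a in [set: A]) (p a)%:E = 1%:E ->
  'E_Pr[occupancy_mass p X r]%E =
  \esum_(a in [set: A]) (occupancy_weight n r (p a))%:E.
Proof.
move=> A_discrete X_iid Ac Ainf p0 p1.
have /card_set_bijP[e be] : ([set: nat] #= [set: A])%card.
  by rewrite card_eq_sym; apply: eq_card_nat.
pose f a w := (p a * (occupancy X a w == r)%:R)%:E.
have f0 a w : (0 <= f a w)%E by rewrite lee_fin mulr_ge0.
have fI a : f a = fun w =>
    ((p a)%:E * (\1_[set w | occupancy X a w == r] w)%:E)%E.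
  apply/funext => w; rewrite /f -EFinM indicE.
  congr ((_ * (nat_of_bool _)%:R)%:E).
  by apply/idP/idP; rewrite inE.
have mI a : measurable_fun [set: T]
    (fun w => (\1_[set w | occupancy X a w == r] w : R)%:E).
  apply/measurable_EFinP; apply: measurable_indic.
  exact: measurable_occupancy_event.
have mf a : measurable_fun [set: T] (f a).
  by rewrite fI; apply: emeasurable_funM.
rewrite unlock.
(* the random sum is at most [\sum_a p a = 1], so [fine] is harmless *)
transitivity (\int[Pr]_w (\esum_(a in [set: A]) f a w))%E.
  apply: eq_integral => w _; rewrite fineK //.
  rewrite ge0_fin_numE; last by apply: esum_ge0 => a _; exact: f0.
  apply: (@le_lt_trans _ _ (\esum_(a in [set: A]) (p a)%:E)).
    apply: le_esum => a _; rewrite lee_fin ler_piMr //.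
    by case: (_ == _).
  by rewrite p1 ltry.
rewrite (integral_esum Pr be mf f0); apply: eq_esum => a _.
rewrite fI ge0_integralZl_EFin //.
rewrite integral_indic //; last exact: measurable_occupancy_event.
rewrite setIT /occupancy_weight EFinM; congr (_ * _)%E.
exact: probability_occupancy.
Qed.

(** * The bound on the mean occupancy mass *)

Theorem corollary2p2 (R : realType)
  (* the alphabet, with its discrete sigma-algebra *)
  (d' : measure_display) (A : measurableType d')
  (A_countable : countable [set: A])
  (A_discrete : forall B : set A, measurable B)
  (p : A -> R)
  (p_01 : forall a, 0 <= p a <= 1)
  (p_sum1 : \esum_(a in [set: A]) (p a)%:E = 1%:E)
  (support_infinite : infinite_set [set a | 0 < p a])
  (alpha : R) (alpha_01 : 0 <= alpha <= 1)
  (ell : R -> R) (ell_sv : slowly_varying ell)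
  (nu_le : forall eps : R, 0 < eps <= 1 ->
     (counting_fun p eps <= (eps `^ (- alpha) * ell (1 / eps))%:E)%E)
  (ell_noninc : {in `[0, +oo[ &, nonincreasing_fun ell})
  (d : measure_display) (T : measurableType d) (Pr : probability T R)
  (n r : nat) (n_ge2 : (2 <= n)%N) (r_le : (r <= n - 1)%N)
  (X : 'I_n -> {RV Pr >-> A}) (X_iid : iid_with_law p X) :
  ('E_Pr[occupancy_mass p X r]
     <= c1_const alpha r * (n%:R `^ (alpha - 1) * ell n%:R)%:E)%E.
Proof.
have n0 : (0 < n)%N by apply: leq_trans n_ge2.
have rn : (r <= n)%N by apply: leq_trans r_le _; rewrite leq_subr.
have n0R : 0 < n%:R :> R by rewrite ltr0n.
rewrite (expectation_occupancy_mass r A_discrete X_iid) //; last 2 first.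
- by apply: sub_infinite_set support_infinite.
- by move=> a; case/andP: (p_01 a).
(* [1 / eps >= n] and [ell] is non-increasing *)
have nuL (eps : R) : 0 < eps <= n%:R^-1 ->
    (counting_fun p eps <= (eps `^ (- alpha) * ell n%:R)%:E)%E.
  move=> /andP[e0 en].
  have ne : n%:R <= 1 / eps.
    by rewrite ler_pdivlMr // mulrC -ler_pdivlMr // div1r.
  apply: le_trans (nu_le _ _) _.
    rewrite e0 (le_trans en) // invf_le1 // ler1n //.
  rewrite lee_fin ler_wpM2l ?powR_ge0 //.
  by apply: ell_noninc; rewrite ?in_itv /= ?andbT // divr_ge0 // ltW.
have n1 : 0 < (n%:R^-1 : R) <= n%:R^-1 by rewrite invr_gt0 n0R /=.
have L0 : 0 <= ell n%:R.
  have nu0 : (0 <= counting_fun p n%:R^-1)%E.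
    by rewrite /counting_fun /counting; case: ifP; rewrite ?lee_fin ?leey.
  have := le_trans nu0 (nuL _ n1).
  by rewrite lee_fin pmulr_rge0 // powR_gt0 // invr_gt0.
apply: ge_ereal_sup => _ [F [finF _] <-].
rewrite fsbig_finite //= sumEFin.
rewrite (bigID (fun a => n%:R^-1 <= p a)) /= EFinD /c1_const.
rewrite ge0_muleDl; last 2 first.
- by rewrite lee_fin c_const_ge0.
- apply: mule_ge0; last exact: lower_gamma_ge0.
  rewrite lee_fin; apply: mulr_ge0; last exact: powR_ge0.
  by apply: divr_ge0; rewrite ?exprn_ge0.
apply: leeD.
  rewrite -EFinM lee_fin; apply: sum_occupancy_weight_heavy_le => //.
  exact: nuL.
exact: sum_occupancy_weight_light_le.
Qed.
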